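(* Let $0\le d_1\le d_2$ be integers. The integer points in a half (including boundary) of the hexagon $\mathcal{P}(d_1,d_2)$ are in bijection with the generators $A_{i,j},B_{i,j},C_{i,j},D_j$ of the ideal $\mathcal{J}(d_1,d_2)$.
   Context: Fundamental domain: $\mathcal{P}(d_1,d_2)\subset\mathbb{R}^3$ is the convex hull of the six points $(0,d_1,d_1+d_2)$, $(d_1,0,d_1+d_2)$, $(2d_1,d_2,0)$, $(0,d_1+d_2,d_1)$, $(d_1,d_1+d_2,0)$, $(2d_1,0,d_2)$, which lie in the plane $x_1+x_2+x_3=2d_1+d_2$. The line $x_1=d_1$ in this plane, through $(d_1,0,d_1+d_2)$ and $(d_1,d_1+d_2,0)$, is an axis of symmetry; a half of $\mathcal{P}(d_1,d_2)$ is one of the two closed pieces it cuts out, e.g. the one with $x_1\ge d_1$. Generators: $\mathcal{J}(d_1,d_2)=(t_1-t_2,x_1-x_2)^{d_1}\cap(t_1-t_3,x_1-x_3)^{d_1}\cap(t_2-t_3,x_2-x_3)^{d_2}\subseteq\mathbb{C}[t_1,t_2,t_3,x_1^{\pm1},x_2^{\pm1},x_3^{\pm1}]$. With $a=t_1-t_2$, $b=x_1-x_2$, $c=t_3-t_2$, $d=x_3-x_2$, it is generated by the following polynomials for $0\le j\le d_1$: $A_{i,j}=a^{d_1-j}c^{d_2-j}(a-c)^i(b-d)^{d_1-j-i}(ad-bc)^j$ ($1\le i\le d_1-j$); $B_{i,j}=a^{d_1-j-i}b^id^{d_2-j}(b-d)^{d_1-j}(ad-bc)^j$ ($1\le i\le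 d_1-j$); $C_{i,j}=a^{d_1-j}c^id^{d_2-j-i}(b-d)^{d_1-j}(ad-bc)^j$ ($1\le i\le d_2-j$); $D_j=a^{d_1-j}d^{d_2-j}(b-d)^{d_1-j}(ad-bc)^j$. *)

(* Defs.v *)
From HB Require Import structures.
From mathcomp Require Import all_boot all_order all_algebra.
From mathcomp Require Import boolp classical_sets functions reals convex.
From mathcomp Require Import complex.
From mathcomp.multinomials Require Import mpoly.

Set Implicit Arguments.
Unset Strict Implicit.
Unset Printing Implicit Defensive.

Import Order.TTheory GRing.Theory Num.Theory.

Local Open Scope classical_set_scope.
Local Open Scope ring_scope.

Section Hexagon.
Variables (R : realType) (d1 d2 : nat).

Definition convex_hull (V : set 'rV[R]_3) : set 'rV[R]_3 :=
  smallest (@convex_set R 'rV[R]_3) V.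

Definition vertex (x1 x2 x3 : nat) : 'rV[R]_3 :=
  \row_(i < 3) (nth 0%N [:: x1; x2; x3] i)%:R.

Definition hexagon_vertices : set 'rV[R]_3 :=
  [set` [:: vertex 0 d1 (d1 + d2);
            vertex d1 0 (d1 + d2);
            vertex (2 * d1) d2 0;
            vertex 0 (d1 + d2) d1;
            vertex d1 (d1 + d2) 0;
            vertex (2 * d1) 0 d2 ] ].

Definition hexagon : set 'rV[R]_3 := convex_hull hexagon_vertices.

(* [x 0 0] is the first coordinate of the row vector [x]. *)
Definition is_half_hexagon (H : set 'rV[R]_3) : Prop :=
  H = hexagon `&` [set x | d1%:R <= x 0 0] \/
  H = hexagon `&` [set x | x 0 0 <= d1%:R].

Definition integer_points : set 'rV[R]_3 :=
  [set x | forall i : 'I_3, x 0 i \is a Num.int].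

End Hexagon.

Arguments hexagon_vertices : clear implicits.
Arguments hexagon : clear implicits.
Arguments integer_points : clear implicits.

Section Generators.
Variable R : realType.

(* C[t1, t2, t3, x1, x2, x3]: the ideal
     J(d1, d2) = (t1 - t2, x1 - x2)^d1 /\ (t1 - t3, x1 - x3)^d1
                 /\ (t2 - t3, x2 - x3)^d2
   lives in the localization of this ring at x1 x2 x3, but its generators
   below have no denominators.  Variables are indexed from 0: [t_ i] is
   t_(i+1) and [x_ i] is x_(i+1). *)
Notation polyring := {mpoly R[i][3 + 3]}.

Definition t_ (i : 'I_3) : polyring := 'X_(lshift 3 i).
Definition x_ (i : 'I_3) : polyring := 'X_(rshift 3 i).

Definition ga : polyring := t_ 0 - t_ 1.
Definition gb : polyring := x_ 0 - x_ 1.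
Definition gc : polyring := t_ 2 - t_ 1.
Definition gd : polyring := x_ 2 - x_ 1.
Definition gdelta : polyring := ga * gd - gb * gc.

Variables (d1 d2 : nat).

(* Truncated subtraction in the exponents is harmless: in [J_generators] one
   has j <= d1 <= d2 and i <= d1 - j (resp. i <= d2 - j). *)
Definition genA (i j : nat) : polyring :=
  ga ^+ (d1 - j) * gc ^+ (d2 - j) * (ga - gc) ^+ i
  * (gb - gd) ^+ (d1 - j - i) * gdelta ^+ j.

Definition genB (i j : nat) : polyring :=
  ga ^+ (d1 - j - i) * gb ^+ i * gd ^+ (d2 - j)
  * (gb - gd) ^+ (d1 - j) * gdelta ^+ j.

Definition genC (i j : nat) : polyring :=
  ga ^+ (d1 - j) * gc ^+ i * gd ^+ (d2 - j - i)
  * (gb - gd) ^+ (d1 - j) * gdelta ^+ j.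

Definition genD (j : nat) : polyring :=
  ga ^+ (d1 - j) * gd ^+ (d2 - j) * (gb - gd) ^+ (d1 - j) * gdelta ^+ j.

Definition J_generators : set polyring :=
  [set g | exists2 j : nat, (j <= d1)%N &
     [\/ exists2 i : nat, (1 <= i <= d1 - j)%N & g = genA i j,
         exists2 i : nat, (1 <= i <= d1 - j)%N & g = genB i j,
         exists2 i : nat, (1 <= i <= d2 - j)%N & g = genC i j
       | g = genD j]].

End Generators.

Arguments J_generators : clear implicits.

(* Main.v *)
Require Import Defs.
From HB Require Import structures.
From mathcomp Require Import all_boot all_order all_algebra.
From mathcomp Require Import boolp classical_sets functions reals convex.
From mathcomp Require Import complex.
From mathcomp.multinomials Require Import mpoly.
From mathcomp Require Import interval_inference zify ring lra.
Import Order.TTheory GRing.Theory Num.Theory.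

Local Open Scope classical_set_scope.

(** Both sides are in bijection with the integer points (k, y), k, y >= 0, of
the trapezoid k <= d1, k + y <= d1 + d2.

Points.  Cutting the hexagon along x1 = d1 leaves two trapezoids, each of which
is an affine image of the real trapezoid 0 <= u <= d1, 0 <= v,
u + v <= d1 + d2, under a map ([trapezoid_point]) that preserves integrality in
both directions; u is the distance of x1 to d1.  That each half lies in such an
image is seen from linear inequalities valid on the hexagon
([hexagon_sub_ineqs]).  Conversely a point of the trapezoid lies between two
points of the slanted sides, and these lie between vertices of the hexagon
([hexagon_trapezoid_point]).

Generators.  The j-th hook of the trapezoid, min(k, y) = j, consists of
2 d1 + d2 + 1 - 3 j points, exactly the number of generators with index j.
Walking along the hook, from the end k = d1 of its arm y = j to the end
y = d1 + d2 - j of its arm k = j, gives the generators B_{i,j} with i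
decreasing, then D_j at the corner, then C_{i,j} and finally A_{i,j} with i
increasing ([hook_generator]).  No two of these polynomials coincide: each is
homogeneous both in t and in x, of degree d1 + y - k in t and of total degree
2 d1 + d2 - min(k, y) ([bihom_hook_generator]); so the bidegree determines
y - k and min(k, y), hence (k, y). *)

(** * The integer points of a half hexagon *)

Definition trapezoid (d1 d2 : nat) : set (nat * nat) :=
  [set p | (p.1 <= d1)%N /\ (p.1 + p.2 <= d1 + d2)%N].

Section Points.
Local Open Scope ring_scope.
Set Implicit Arguments.
Unset Strict Implicit.
Variable R : realType.

Definition row3 (a b c : R) : 'rV[R]_3 := \row_(i < 3) nth 0 [:: a; b; c] i.

Lemma row3_eta (x : 'rV[R]_3) : x = row3 (x 0 0) (x 0 1) (x 0 2).
Proof.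
by apply/rowP; case=> [[|[|[|//]]] ?]; rewrite mxE /=; congr (x 0 _); apply: val_inj.
Qed.

Lemma convex_comb (C : set 'rV[R]_3) (l : R) (x y : 'rV[R]_3) :
  convex_set C -> 0 <= l <= 1 -> C x -> C y -> C (l *: x + (1 - l) *: y).
Proof.
move=> cvC /andP[l0 l1] /mem_set Cx /mem_set Cy.
exact: (set_mem (cvC _ _ (Itv01 l0 l1) Cx Cy)).
Qed.

Lemma convex_hull_convex (V : set 'rV[R]_3) : convex_set (convex_hull V).
Proof.
move=> x y l /set_mem hx /set_mem hy; apply: mem_set => C [cvC sVC].
by apply: set_mem (cvC _ _ l (mem_set _) (mem_set _)); [apply: hx | apply: hy].
Qed.

(** Lets points of a segment be written as convex combinations without excluding
degenerate segments: when D = 0 the ratio is arbitrary. *)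
Lemma ratio_exists (u D : R) :
  0 <= u <= D -> exists2 l, 0 <= l <= 1 & u = l * D.
Proof.
move=> /andP[u0 uD]; have [D0|D0] := eqVneq D 0.
  by exists 0; [rewrite lexx ler01 | lra].
have Dgt0 : 0 < D by rewrite lt_neqAle eq_sym D0 (le_trans u0).
by exists (u / D); rewrite ?divfK// divr_ge0 ?ler_pdivrMr ?mul1r ?(ltW Dgt0).
Qed.

Variables d1 d2 : nat.
Implicit Types (s : bool) (u v l : R).

Definition half_hexagon s : set 'rV[R]_3 :=
  hexagon R d1 d2 `&`
  [set x | if s then x 0 0 <= d1%:R else d1%:R <= x 0 0].

(** For [s] false this parametrizes the half x1 >= d1; for [s] true, the half
x1 <= d1, by composing with the affine symmetry
(x1, x2, x3) |-> (2 d1 - x1, x2 + x1 - d1, x3 + x1 - d1) of the hexagon. *)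
Definition trapezoid_point s u v : 'rV[R]_3 :=
  if s then row3 (d1%:R - u) (v + u) (d1%:R + d2%:R - v)
  else row3 (d1%:R + u) v (d1%:R + d2%:R - u - v).

(** The parametrization is affine, so convexity arguments can be carried out on
the parameters, for both halves at once. *)
Lemma trapezoid_point_comb s l u v u' v' :
  l *: trapezoid_point s u v + (1 - l) *: trapezoid_point s u' v' =
  trapezoid_point s (l * u + (1 - l) * u') (l * v + (1 - l) * v').
Proof.
rewrite /trapezoid_point; apply/rowP; case: s; case=> [[|[|[|//]]] ?];
  rewrite !mxE /=; ring.
Qed.

Definition hexagon_ineqs : set 'rV[R]_3 :=
  [set x | [/\ x 0 0 + x 0 1 + x 0 2 = 2 * d1%:R + d2%:R,
              0 <= x 0 0 <= 2 * d1%:R,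
              0 <= x 0 1 <= d1%:R + d2%:R &
              0 <= x 0 2 <= d1%:R + d2%:R] ].

Lemma hexagon_sub_ineqs : hexagon R d1 d2 `<=` hexagon_ineqs.
Proof.
apply: smallest_sub => [x y l|x].
  move=> /set_mem[xs /andP[x0 x1] /andP[x2 x3] /andP[x4 x5]].
  move=> /set_mem[ys /andP[y0 y1] /andP[y2 y3] /andP[y4 y5]].
  apply: mem_set; rewrite /hexagon_ineqs /= /conv /= !mxE.
  have l0 : 0 <= l%:num by [].
  have l1 : 0 <= 1 - l%:num by rewrite subr_ge0.
  rewrite /unstable.onem; split; nra.
rewrite /hexagon_vertices /= !inE => /or4P[/eqP->|/eqP->|/eqP->|];
  last move=> /or3P[/eqP->|/eqP->|/eqP->].
all: have := ler0n R d1; have := ler0n R d2.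
all: rewrite /hexagon_ineqs /vertex /= !mxE /= ?natrD ?natrM.
all: by move=> *; split; lra.
Qed.

(** The four corners of the trapezoid are vertices of the hexagon.  Interpolating
along the two sides v = 0 and u + v = d1 + d2 reaches height u on each of them,
and interpolating between these two points reaches (u, v). *)
Lemma hexagon_trapezoid_point s u v :
  0 <= u <= d1%:R -> 0 <= v -> u + v <= d1%:R + d2%:R ->
  hexagon R d1 d2 (trapezoid_point s u v).
Proof.
move=> u_itv v0 uv.
have vtx x1 x2 x3 : vertex R x1 x2 x3 = row3 x1%:R x2%:R x3%:R.
  by apply/rowP; case=> [[|[|[|//]]] ?]; rewrite !mxE.
have corner x1 x2 x3 : vertex R x1 x2 x3 \in
    [:: vertex R 0 d1 (d1 + d2); vertex R d1 0 (d1 + d2);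
        vertex R (2 * d1) d2 0; vertex R 0 (d1 + d2) d1;
        vertex R d1 (d1 + d2) 0; vertex R (2 * d1) 0 d2] ->
    hexagon R d1 d2 (vertex R x1 x2 x3).
  by move=> vx; apply: sub_gen_smallest.
(* The corners at u = 0, then those at u = d1. *)
have base v' : v' = 0 \/ v' = d1%:R + d2%:R ->
    hexagon R d1 d2 (trapezoid_point s 0 v').
  case=> ->.
    have -> : trapezoid_point s 0 0 = vertex R d1 0 (d1 + d2).
      by rewrite vtx natrD; case: (s); rewrite /trapezoid_point; congr row3; ring.
    by apply: corner; rewrite !inE eqxx ?orbT.
  have -> : trapezoid_point s 0 (d1%:R + d2%:R) = vertex R d1 (d1 + d2) 0.
    by rewrite vtx natrD; case: (s); rewrite /trapezoid_point; congr row3; ring.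
  by apply: corner; rewrite !inE eqxx ?orbT.
have top v' : v' = 0 \/ v' = d2%:R ->
    hexagon R d1 d2 (trapezoid_point s d1%:R v').
  case=> ->.
    have -> : trapezoid_point s d1%:R 0 =
        if s then vertex R 0 d1 (d1 + d2) else vertex R (2 * d1) 0 d2.
      by rewrite !vtx natrD natrM; case: (s); rewrite /trapezoid_point;
        congr row3; ring.
    by case: (s); apply: corner; rewrite !inE eqxx ?orbT.
  have -> : trapezoid_point s d1%:R d2%:R =
      if s then vertex R 0 (d1 + d2) d1 else vertex R (2 * d1) d2 0.
    by rewrite !vtx natrD natrM; case: (s); rewrite /trapezoid_point;
      congr row3; ring.
  by case: (s); apply: corner; rewrite !inE eqxx ?orbT.
have cvH := @convex_hull_convex (hexagon_vertices R d1 d2).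
have [l l01 ul] := ratio_exists u_itv.
have left_edge : hexagon R d1 d2 (trapezoid_point s u 0).
  have := convex_comb cvH l01 (top 0 (or_introl erefl)) (base 0 (or_introl erefl)).
  by rewrite trapezoid_point_comb -ul !mulr0 !addr0.
have right_edge : hexagon R d1 d2 (trapezoid_point s u (d1%:R + d2%:R - u)).
  have := convex_comb cvH l01 (top _ (or_intror erefl)) (base _ (or_intror erefl)).
  rewrite trapezoid_point_comb mulr0 addr0 -ul.
  by congr (hexagon _ _ _ (trapezoid_point s u _)); rewrite ul; ring.
have v_itv : 0 <= v <= d1%:R + d2%:R - u by lra.
have [m m01 vm] := ratio_exists v_itv.
have := convex_comb cvH m01 right_edge left_edge.
rewrite trapezoid_point_comb mulr0 addr0 -vm.
by congr (hexagon _ _ _ (trapezoid_point s _ v)); ring.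
Qed.

Lemma half_hexagonP s (x : 'rV[R]_3) :
  half_hexagon s x <->
  exists u v, [/\ 0 <= u <= d1%:R, 0 <= v, u + v <= d1%:R + d2%:R
                & x = trapezoid_point s u v].
Proof.
split=> [[/hexagon_sub_ineqs[xs /andP[x0 x1] /andP[x2 x3] /andP[x4 x5]] side]|].
  case: s side => /= side.
    exists (d1%:R - x 0 0), (x 0 1 - (d1%:R - x 0 0)); split; [lra | lra | lra |].
    by rewrite [LHS]row3_eta /trapezoid_point; congr row3; lra.
  exists (x 0 0 - d1%:R), (x 0 1); split; [lra | lra | lra |].
  by rewrite [LHS]row3_eta /trapezoid_point; congr row3; lra.
move=> [u [v [u_itv v0 uv ->]]]; split; first exact: hexagon_trapezoid_point.
by rewrite /= /trapezoid_point; case: s; rewrite mxE /=; lra.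
Qed.

Lemma trapezoid_point_int s u v :
  integer_points R (trapezoid_point s u v) <->
  u \is a Num.int /\ v \is a Num.int.
Proof.
have d1Z : d1%:R \is a @Num.int R by exact: rpred_nat.
have d2Z : d2%:R \is a @Num.int R by exact: rpred_nat.
split=> [xZ|[uZ vZ] i]; last first.
  by case: s; rewrite mxE /=; case: i => [[|[|[|//]]] ?] /=;
    rewrite ?(rpredB, rpredD).
move: (xZ 0) (xZ 1); rewrite /trapezoid_point; case: s {xZ}.
  rewrite !mxE /= => aZ bZ.
  have uZ : u \is a Num.int.
    by have -> : u = d1%:R - (d1%:R - u); [ring | rewrite rpredB].
  by split=> //; have -> : v = v + u - u; [ring | rewrite rpredB].
rewrite !mxE /= => aZ bZ; split=> //.
by have -> : u = d1%:R + u - d1%:R; [ring | rewrite rpredB].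
Qed.

Lemma trapezoid_point_bij s :
  set_bij (trapezoid d1 d2) (half_hexagon s `&` integer_points R)
    (fun p => trapezoid_point s p.1%:R p.2%:R).
Proof.
split.
- move=> [k y] [/= kd kyd]; split; last first.
    by apply/trapezoid_point_int; rewrite !rpred_nat.
  apply/half_hexagonP; exists k%:R, y%:R; split=> //.
  + by rewrite ler0n ler_nat.
  + by rewrite -!natrD ler_nat.
- move=> [k y] [k' y'] _ _ /= /[dup].
  move=> /(congr1 (fun x : 'rV_3 => x 0 0)) + /(congr1 (fun x : 'rV_3 => x 0 1)).
  rewrite /trapezoid_point; case: s; rewrite !mxE /= => e0 e1.
    have /eqP : k%:R = k'%:R :> R by lra.
    have /eqP : y%:R = y'%:R :> R by lra.
    by rewrite !eqr_nat => /eqP-> /eqP->.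
  have /eqP : k%:R = k'%:R :> R by lra.
  by move/eqP: e1; rewrite !eqr_nat => /eqP-> /eqP->.
- move=> x [/half_hexagonP[u [v [/andP[u0 ud] v0 uv ->]]]].
  move=> /trapezoid_point_int[].
  rewrite !intrEge0// => /natrP[k uk] /natrP[y vy].
  rewrite uk vy -?natrD ?ler_nat in ud uv *.
  by exists (k, y).
Qed.

End Points.

(** * The generators, arranged along hooks *)

Section Generators.
Local Open Scope ring_scope.
Set Implicit Arguments.
Unset Strict Implicit.
Variable R : realType.
Notation K := (R[i]).

(** The point t = a (3, 0, 1), x = b (2, 0, 1); for nonzero a and b none of the
factors occurring in the generators vanishes there. *)
Definition sample (a b : K) (m : 'I_(3 + 3)) : K :=
  nth 0 [:: 3 * a; 0; a; 2 * b; 0; b] m.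

(** The part of bihomogeneity, of degree p in t and q in x, that is visible on
the sample points.  Asking for a nonzero constant makes (p, q) unique and is
stable under products. *)
Definition bihom (p q : nat) (g : {mpoly K[3 + 3]}) : Prop :=
  exists2 c : K, c != 0 &
    forall a b : K, g.@[sample a b] = c * a ^+ p * b ^+ q.

Lemma bihomM p q p' q' g g' :
  bihom p q g -> bihom p' q' g' -> bihom (p + p') (q + q') (g * g').
Proof.
move=> [c c0 cE] [c' c'0 cE']; exists (c * c'); first by rewrite mulf_neq0.
by move=> a b; rewrite mevalM cE cE' !exprD; ring.
Qed.

Lemma bihomX p q g n : bihom p q g -> bihom (p * n) (q * n) (g ^+ n).
Proof.
move=> [c c0 cE]; exists (c ^+ n); first by rewrite expf_neq0.
by move=> a b; rewrite rmorphXn /= cE !exprMn -!exprM.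
Qed.

Lemma bihom_inj p q p' q' g :
  bihom p q g -> bihom p' q' g -> p = p' /\ q = q'.
Proof.
move=> [c c0 cE] [c' c'0 cE'].
(* The constants agree at a = b = 1; then a = 2 and b = 2 separate exponents. *)
have E a b : c * a ^+ p * b ^+ q = c' * a ^+ p' * b ^+ q' by rewrite -cE -cE'.
have Ecc : c = c' by have := E 1 1; rewrite !expr1n !mulr1.
have two : injective (GRing.exp (2 : K)).
  by apply: ieexprIn; rewrite ?ltr0n// (eqr_nat _ 2 1).
split; apply: two; apply: (mulfI c0).
  by have := E 2 1; rewrite !expr1n !mulr1 -Ecc.
by have := E 1 2; rewrite !expr1n !mulr1 -Ecc.
Qed.

Lemma bihom_factors :
  [/\ bihom 1 0 (ga R), bihom 0 1 (gb R), bihom 1 0 (gc R) &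
      bihom 0 1 (gd R)] /\
  [/\ bihom 1 0 (ga R - gc R), bihom 0 1 (gb R - gd R) &
      bihom 1 1 (gdelta R)].
Proof.
have nz n : n.+1%:R != 0 :> K by rewrite pnatr_eq0.
have fE := (mevalB, mevalM, mevalXU).
do 2!split.
- by exists 3 => [|a b]; [exact: nz 2 | rewrite !fE /sample /=; ring].
- by exists 2 => [|a b]; [exact: nz 1 | rewrite !fE /sample /=; ring].
- by exists 1 => [|a b]; [exact: nz 0 | rewrite !fE /sample /=; ring].
- by exists 1 => [|a b]; [exact: nz 0 | rewrite !fE /sample /=; ring].
- by exists 2 => [|a b]; [exact: nz 1 | rewrite !fE /sample /=; ring].
- by exists 1 => [|a b]; [exact: nz 0 | rewrite !fE /sample /=; ring].
- by exists 1 => [|a b]; [exact: nz 0 | rewrite !fE /sample /=; ring].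
Qed.

Variables d1 d2 : nat.

(** The corner of the hook through (k, y) is (j, j) with j = min(k, y); on the arm
k = j, the generators C_{i,j} stop at y = d2, where i = d2 - j, and A_{i,j}
takes over. *)
Definition hook_generator (p : nat * nat) : {mpoly K[3 + 3]} :=
  let: (k, y) := p in
  if (y < k)%N then genB R d1 d2 (k - y) y
  else if y == k then genD R d1 d2 k
  else if (y <= d2)%N then genC R d1 d2 (y - k) k
  else genA R d1 d2 (y - d2) k.

(** The subtrahends do not exceed the other terms: k <= d1 and
y + min(k, y) <= d1 + d2 + k on the trapezoid. *)
Lemma bihom_hook_generator k y : (d1 <= d2)%N -> trapezoid d1 d2 (k, y) ->
  bihom (d1 + y - k) (d1 + d2 + k - y - minn k y) (hook_generator (k, y)).
Proof.
move=> hd [/= kd kyd].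
have [[ha hb hc hd'] [hac hbd hdelta]] := bihom_factors.
rewrite /hook_generator /genA /genB /genC /genD.
have eq_bihom p q p' q' g : p = p' -> q = q' -> bihom p' q' g -> bihom p q g.
  by move=> -> ->.
case: ltnP => yk; last case: eqP => eyk; last case: leqP => yd2.
all: apply: eq_bihom; last (do ![apply: bihomM | apply: bihomX | eassumption]).
all: lia.
Qed.

Lemma hook_generator_bij : (d1 <= d2)%N ->
  set_bij (trapezoid d1 d2) (J_generators R d1 d2) hook_generator.
Proof.
move=> hd; split.
- move=> [k y] [/= kd kyd].
  case: ltnP => yk.
    by exists y; [lia | constructor 2; exists (k - y)%N => //; lia].
  case: eqP => [eyk|nyk]; first by exists k; [lia | constructor 4].
  case: leqP => yd2; exists k => //.
    by constructor 3; exists (y - k)%N => //; lia.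
  by constructor 1; exists (y - d2)%N => //; lia.
- move=> [k y] [k' y'] /set_mem T /set_mem T' e.
  have h := bihom_hook_generator hd T; rewrite e in h.
  have [] := bihom_inj h (bihom_hook_generator hd T').
  case: T T' => /= ? ? [/= ? ?] ? ?.
  by congr pair; lia.
- move=> g [j jd [[i i_itv ->]|[i i_itv ->]|[i i_itv ->]|->]].
  + exists (j, d2 + i)%N; first by split=> /=; lia.
    rewrite /hook_generator ifF 1?ifF 1?ifF ?addKn //; lia.
  + exists (j + i, j)%N; first by split=> /=; lia.
    rewrite /hook_generator ifT ?addKn //; lia.
  + exists (j, j + i)%N; first by split=> /=; lia.
    rewrite /hook_generator ifF 1?ifF ?ifT ?addKn //; lia.
  + exists (j, j); first by split=> /=; lia.
    by rewrite /hook_generator ltnn eqxx.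
Qed.

End Generators.

Theorem theoremA12 (R : realType) (d1 d2 : nat) (hd : (d1 <= d2)%N)
    (H : set 'rV[R]_3) (hH : is_half_hexagon d1 d2 H) :
  exists f : 'rV[R]_3 -> {mpoly R[i][3 + 3]},
    set_bij (H `&` integer_points R) (J_generators R d1 d2) f.
Proof.
have [s ->] : exists s, H = half_hexagon d1 d2 s.
  by case: hH => ->; [exists false | exists true].
exists (@hook_generator R d1 d2 \o
  'pinv_(fun=> (0, 0)%N) (trapezoid d1 d2)
    (fun p => @trapezoid_point R d1 d2 s p.1%:R%R p.2%:R%R)).
apply: set_bij_comp (hook_generator_bij R hd).
exact/bijpinv_bij/trapezoid_point_bij.
Qed.
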